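(* Let $S,L,K\ge 1$ be integers and $N=SL$. Let $\mathbf{Q}\in\mathbb{C}^{N\times L}$ be a matrix of the form $[\mathbf{Q}]_{(l_1-1)S+s,\,l_2}=q_{l_1,s}$ if $l_1=l_2$ and $0$ if $l_1\neq l_2$ ($l_1,l_2\in\{1,\dots,L\}$, $s\in\{1,\dots,S\}$), where each $q_{l,s}\in\mathcal{Q}=\{(\jmath+e^{\jmath\theta})/2:\theta\in[0,2\pi]\}$. Let $\mathbf{H}\in\mathbb{C}^{N\times N}$ be a fixed diagonal matrix, $N_0>0$, and assume $\mathbf{P}=N_0\mathbf{Q}^{\mathsf H}\mathbf{H}^{\mathsf H}\mathbf{H}\mathbf{Q}$ is invertible. For $k=1,\dots,K$ let $$\mathbf{g}_k=\sqrt{\tfrac{\alpha_kK_0}{1+K_0}}\,\bar{\mathbf{g}}_k+\sqrt{\tfrac{\alpha_k}{1+K_0}}\,\mathbf{R}_k^{1/2}\hat{\mathbf{g}}_k,$$ where $\alpha_k>0$, $K_0\ge 0$, $\bar{\mathbf{g}}_k\in\mathbb{C}^N$ is deterministic, $\mathbf{R}_k\in\mathbb{C}^{N\times N}$ is a deterministic Hermitian positive semidefinite matrix, and $\hat{\mathbf{g}}_k\sim\mathcal{CN}(\mathbf{0}_N,\mathbf{I}_N)$. Define $\tilde{\mathbf{G}}_k=\big[\sqrt{\tfrac{\alpha_kK_0}{1+K_0}}\bar{\mathbf{g}}_k,\ \sqrt{\tfrac{\alpha_k}{1+K_0}}\mathbf{R}_k^{1/2}\big]\in\mathbb{C}^{N\times(N+1)}$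 and $\mathbf{G}=[\tilde{\mathbf{G}}_1,\dots,\tilde{\mathbf{G}}_K]\in\mathbb{C}^{N\times K(N+1)}$. Then $$\mathbb{E}\Big\{\log\det\Big(\mathbf{I}_L+\mathbf{Q}^{\mathsf H}\mathbf{H}^{\mathsf H}\sum_{k=1}^K\mathbf{g}_k\mathbf{g}_k^{\mathsf H}\mathbf{H}\mathbf{Q}\,\mathbf{P}^{-1}\Big)\Big\}\ \le\ \log\det\Big(\mathbf{I}_L+\mathbf{Q}^{\mathsf H}\mathbf{H}^{\mathsf H}\mathbf{G}\mathbf{G}^{\mathsf H}\mathbf{H}\mathbf{Q}\,\mathbf{P}^{-1}\Big).$$
   Context: The left-hand side is the ergodic uplink sum rate with MMSE-SIC decoding for a dynamic metasurface antenna (DMA) receiver with weight matrix $\mathbf{Q}$ and microstrip propagation matrix $\mathbf{H}$; $\jmath$ is the imaginary unit, $(\cdot)^{\mathsf H}$ is conjugate transpose, $\mathbf{R}_k^{1/2}$ is the Hermitian positive semidefinite square root, and $\mathcal{CN}(\mathbf{0},\mathbf{I})$ is the circularly-symmetric complex Gaussian distribution. *)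

(* Defs.v *)
From HB Require Import structures.
From mathcomp Require Import all_boot all_order all_algebra.
From mathcomp Require Import all_classical all_reals all_analysis.
From mathcomp Require Import complex.
Set Implicit Arguments. Unset Strict Implicit. Unset Printing Implicit Defensive.
Import Order.TTheory GRing.Theory Num.Theory.
Local Open Scope classical_set_scope.
Local Open Scope ring_scope.
Local Open Scope complex_scope.

Definition adjmx (R : realType) (m n : nat) (A : 'M[R[i]]_(m, n)) : 'M[R[i]]_(n, m) :=
  (map_mx (@conjc R) A)^T.

Definition hermitian (R : realType) (n : nat) (A : 'M[R[i]]_n) : Prop :=
  adjmx A = A.

(* Hermitian positive semidefinite (order on R[i]: 0 <= z iff z real, >= 0) *)
Definition psd (R : realType) (n : nat) (A : 'M[R[i]]_n) : Prop :=
  hermitian A /\ forall v : 'cV[R[i]]_n, 0 <= (adjmx v *m A *m v) 0 0.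

Definition dma_weights (R : realType) : set R[i] :=
  [set q | exists theta : R, 0 <= theta <= pi *+ 2 /\
      q = ('i + (cos theta +i* sin theta)) / 2%:R].

(* log det of a matrix whose determinant is a positive real number
   (natural logarithm of the real part of the determinant) *)
Definition logdet (R : realType) (n : nat) (M : 'M[R[i]]_n) : R :=
  ln (complex.Re (\det M)).

(* g : T -> C^N is a standard circularly-symmetric complex Gaussian vector
   CN(0, I_N): its 2N real coordinates (real and imaginary parts) are
   measurable, mutually independent, and each N(0, 1/2) distributed. *)
Definition std_cgauss_vec (d : measure_display) (T : measurableType d)
    (R : realType) (P : probability T R) (N : nat) (g : T -> 'cV[R[i]]_N) : Prop :=
  let comp (p : 'I_N * bool) (w : T) : R :=
    if p.2 then complex.Re (g w p.1 0) else complex.Im (g w p.1 0) in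
  [/\ forall p, measurable_fun setT (comp p),
      forall p (B : set R), measurable B ->
        P (comp p @^-1` B) = normal_prob 0 (Num.sqrt (2%:R^-1)) B
    & forall B : 'I_N * bool -> set R, (forall p, measurable (B p)) ->
        P (\bigcap_(p in [set: 'I_N * bool]) (comp p @^-1` B p)) =
        (\prod_(p : 'I_N * bool) P (comp p @^-1` B p))%E].

(* Main.v *)
(* Write X(S) = P + F S F^H with F = Q^H H^H, so that both sides are log det of
   X(S) P^-1, with S = sum_k g_k g_k^H on the left and S = G G^H on the right.
   The matrix G is built so that E[sum_k g_k g_k^H] = G G^H; hence the claim is
   Jensen's inequality for the concave function log det.  Concavity is used in
   tangent form: log det (X Y^-1) <= tr (X Y^-1) - L for positive definite X, Y,
   because the eigenvalues of X Y^-1 are positive and ln x <= x - 1. *)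
Require Import Defs.
From HB Require Import structures.
From mathcomp Require Import all_boot all_order all_algebra.
From mathcomp Require Import all_classical all_reals all_analysis.
From mathcomp Require Import complex measurable_realfun ring lra.
Import Order.TTheory GRing.Theory Num.Theory.
Local Open Scope classical_set_scope.
Local Open Scope ring_scope.
Local Open Scope complex_scope.
Set Implicit Arguments.
Unset Strict Implicit.
Unset Printing Implicit Defensive.

(** * Positive definite matrices and log det *)

Section Adjoint.
Context {R : realType}.
Local Notation C := R[i].

Lemma adjmxM m n p (A : 'M[C]_(m, n)) (B : 'M[C]_(n, p)) :
  adjmx (A *m B) = adjmx B *m adjmx A.
Proof. by rewrite /adjmx map_mxM trmx_mul. Qed.

Lemma adjmxK m n (A : 'M[C]_(m, n)) : adjmx (adjmx A) = A.
Proof. by apply/matrixP => i j; rewrite !mxE conjcK. Qed.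

Lemma adjmxD m n (A B : 'M[C]_(m, n)) : adjmx (A + B) = adjmx A + adjmx B.
Proof. by apply/matrixP => i j; rewrite !mxE rmorphD. Qed.

Lemma adjmx_self_ge0 n (v : 'cV[C]_n) : 0 <= (adjmx v *m v) 0 0.
Proof. by rewrite mxE sumr_ge0// => i _; rewrite !mxE mulrC mulcJ_ge0. Qed.

Lemma adjmx_self_eq0 n (v : 'cV[C]_n) : (adjmx v *m v) 0 0 = 0 -> v = 0.
Proof.
rewrite mxE => /eqP; rewrite psumr_eq0; last first.
  by move=> i _; rewrite !mxE mulrC mulcJ_ge0.
move=> /allP h; apply/matrixP => i j; rewrite (ord1 j) mxE.
have := h i (mem_index_enum i); rewrite !mxE /= mulf_eq0 conjc_eq0 orbb.
by move=> /eqP.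
Qed.

(** Since [0 <= z] in [R[i]] forces [z] to be real, this condition already implies that [A] is
    Hermitian. *)
Definition possemidef n (A : 'M[C]_n) :=
  forall v : 'cV[C]_n, 0 <= (adjmx v *m A *m v) 0 0.

Definition posdef n (A : 'M[C]_n) :=
  forall v : 'cV[C]_n, v != 0 -> 0 < (adjmx v *m A *m v) 0 0.

Lemma possemidef_gram m n (B : 'M[C]_(m, n)) : possemidef (B *m adjmx B).
Proof.
move=> v; have -> : adjmx v *m (B *m adjmx B) *m v =
    adjmx (adjmx B *m v) *m (adjmx B *m v) by rewrite adjmxM adjmxK !mulmxA.
exact: adjmx_self_ge0.
Qed.

Lemma possemidef_sum n I (r : seq I) (A : I -> 'M[C]_n) :
  (forall i, possemidef (A i)) -> possemidef (\sum_(i <- r) A i).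
Proof.
move=> h v; rewrite mulmx_sumr mulmx_suml summxE sumr_ge0// => i _.
exact: h.
Qed.

Lemma possemidef_congr m n (B : 'M[C]_(m, n)) (A : 'M[C]_n) :
  possemidef A -> possemidef (B *m A *m adjmx B).
Proof.
move=> h v; have -> : adjmx v *m (B *m A *m adjmx B) *m v =
    adjmx (adjmx B *m v) *m A *m (adjmx B *m v).
  by rewrite adjmxM adjmxK !mulmxA.
exact: h.
Qed.

Lemma posdefD n (A B : 'M[C]_n) : posdef A -> possemidef B -> posdef (A + B).
Proof.
by move=> hA hB v v0; rewrite mulmxDr mulmxDl mxE ltr_pwDl ?hA ?hB.
Qed.

(** A nonzero row [u] of the left kernel would make the quadratic form vanish at the nonzero vector
    [adjmx u]. *)
Lemma posdef_unit n (A : 'M[C]_n) : posdef A -> A \in unitmx.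
Proof.
move=> hA; rewrite -row_free_unit -kermx_eq0; apply/eqP/row_matrixP => i.
rewrite row0; apply/eqP/negPn/negP => u0; set u := row i _ in u0.
have uA : u *m A = 0.
  by apply/sub_kermxP; exact: row_sub.
have := hA (adjmx u); rewrite adjmxK uA mul0mx mxE ltxx => h; suff: false by [].
apply: h; apply: contra_neq u0 => /(congr1 (@adjmx R _ _)).
by rewrite adjmxK => ->; apply/matrixP => ? ?; rewrite !mxE conjc0.
Qed.

(** The form at [v] is [c] times the squared norm of [adjmx B *m v]. If that norm is zero, the Gram
    matrix kills [v], and invertibility gives [v = 0]. *)
Lemma posdef_gram m n (c : R) (B : 'M[C]_(m, n)) : 0 < c ->
  c%:C *: (B *m adjmx B) \in unitmx -> posdef (c%:C *: (B *m adjmx B)).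
Proof.
move=> c0 hu v v0.
have e : adjmx v *m (B *m adjmx B) *m v =
    adjmx (adjmx B *m v) *m (adjmx B *m v) by rewrite adjmxM adjmxK !mulmxA.
rewrite -scalemxAr -scalemxAl mxE e pmulr_rgt0 ?ltcR//.
rewrite lt_neqAle adjmx_self_ge0 andbT eq_sym.
apply: contra_neq v0 => /adjmx_self_eq0 h.
by rewrite -[v](mulKmx hu) -scalemxAl -mulmxA h mulmx0 scaler0 mulmx0.
Qed.

(** The characteristic polynomial splits; [s] lists its roots with multiplicity, and the determinant
    and trace are read off its constant and subleading coefficients. *)
Lemma closed_field_spectrum (K : closedFieldType) n (A : 'M[K]_n) :
  exists s : seq K, [/\ size s = n, forall x, x \in s -> eigenvalue A x,
    \det A = \prod_(x <- s) x & \tr A = \sum_(x <- s) x].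
Proof.
have [s hs] := closed_field_poly_normal (char_poly A).
rewrite (monicP (char_poly_monic A)) scale1r in hs.
have ss : size s = n.
  by have := size_char_poly A; rewrite hs size_prod_XsubC => -[].
exists s; split => //.
- by move=> x xs; rewrite eigenvalue_root_char hs root_prod_XsubC.
- have := char_poly_det A; rewrite hs coef0_prod_XsubC ss.
  by move=> /(mulfI _)-> //; rewrite signr_eq0.
(* In size 0 there is no subleading coefficient, so the trace is computed directly as an empty
   sum. *)
- have [n0|n0] := posnP n.
    by move: A hs ss; rewrite n0 => A _ /size0nil ->;
       rewrite big_nil /mxtrace big_ord0.
  have := char_poly_trace A n0; rewrite hs -{1}ss coefPn_prod_XsubC; last first.
    by rewrite ss -lt0n.
  by move=> /oppr_inj.
Qed.

(** A left eigenvector [u] satisfies [u *m A = a *: (u *m B)], so [a] is the quotient of the two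
    positive numbers that the forms of [A] and [B] take at [adjmx u]. The product [A *m invmx B]
    itself need not be Hermitian. *)
Lemma eigenvalue_posdef n (A B : 'M[C]_n) (a : C) : posdef A -> posdef B ->
  eigenvalue (A *m invmx B) a -> 0 < a.
Proof.
move=> hA hB /eigenvalueP[u uAB u0].
have uA : u *m A = a *: (u *m B).
  by rewrite -[LHS](mulmxKV (posdef_unit hB)) -(mulmxA u A) uAB -scalemxAl.
have v0 : adjmx u != 0.
  by apply: contra_neq u0 => /(congr1 (@adjmx R _ _)); rewrite adjmxK => ->;
    apply/matrixP => ? ?; rewrite !mxE conjc0.
have b0 := hB _ v0; have := hA _ v0.
by rewrite adjmxK in b0 *; rewrite uA -scalemxAl mxE pmulr_lgt0.
Qed.

Lemma det_posdef_gt0 n (A B : 'M[C]_n) : posdef A -> posdef B ->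
  0 < \det (A *m invmx B).
Proof.
move=> hA hB; have [s [_ hs -> _]] := closed_field_spectrum (A *m invmx B).
rewrite big_seq prodr_gt0// => x /hs; exact: eigenvalue_posdef.
Qed.

(* With [x] ranging over the (positive) eigenvalues of [A B^-1], this is
   [ln x <= x - 1] summed. *)
Lemma logdet_le_trace n (A B : 'M[C]_n) : posdef A -> posdef B ->
  logdet (A *m invmx B) <= complex.Re (\tr (A *m invmx B)) - n%:R.
Proof.
move=> hA hB; rewrite /logdet.
have [s [ss hs -> ->]] := closed_field_spectrum (A *m invmx B).
rewrite -ss {ss}; have {}hs x : x \in s -> 0 < x.
  by move=> /hs; exact: eigenvalue_posdef.
elim: s hs => [|x s IH] hs; first by rewrite !big_nil /= ln1 subr0.
have x0 : 0 < x by rewrite hs ?mem_head.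
have {}hs y : y \in s -> 0 < y by move=> ys; rewrite hs// in_cons ys orbT.
have {}IH := IH hs.
have p0 : 0 < \prod_(y <- s) y by rewrite big_seq prodr_gt0.
rewrite !big_cons; move: IH p0 x0.
case: (\prod_(y <- s) y) => p p'; case: (\sum_(y <- s) y) => t t'.
case: x {hs} => x x' /= IH; rewrite !ltcE /=.
move=> /andP[/eqP-> p0] /andP[/eqP-> x0].
(* Positivity in [R[i]] has made both imaginary parts zero, so the real part of the product is the
   product of the real parts. *)
rewrite mul0r subr0 lnM ?posrE// -(add1n (size s)) natrD.
have := @le_ln1Dx R (x - 1); rewrite (addrC 1) subrK => h.
by rewrite opprD addrACA lerD// h// ltrBrDl subrr.
Qed.

(* Concavity of [logdet]: its graph lies below its tangent plane at [Y]. *)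
Lemma logdet_tangent n (X Y B : 'M[C]_n) : posdef X -> posdef Y -> posdef B ->
  logdet (X *m invmx B) <=
  logdet (Y *m invmx B) + (complex.Re (\tr (X *m invmx Y)) - n%:R).
Proof.
move=> hX hY hB; apply: le_trans (lerD (lexx _) (logdet_le_trace hX hY)).
(* Through this factorization [logdet] becomes a sum, whose only non-constant part in [X] is bounded
   by the trace. *)
have -> : X *m invmx B = X *m invmx Y *m (Y *m invmx B).
  by rewrite mulmxA mulmxKV// posdef_unit.
have := det_posdef_gt0 hX hY; have := det_posdef_gt0 hY hB.
rewrite /logdet [\det (_ *m (_ *m _))]det_mulmx.
case: (\det (Y *m _)) => y y'; case: (\det (X *m _)) => x x'.
rewrite !ltcE /= => /andP[/eqP-> y0] /andP[/eqP-> x0].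
by rewrite mul0r subr0 lnM ?posrE// addrC.
Qed.

End Adjoint.

(** * Gaussian moments *)

Section GaussianMoments.
Context {R : realType}.
Local Notation mu := (@lebesgue_measure R).
Import numFieldNormedType.Exports.

Let is_derive1_continuous (f df : R -> R) :
  (forall x : R, is_derive x 1 f (df x)) -> continuous f.
Proof.
by move=> d x; apply/differentiable_continuous/derivable1_diffP; have [] := d x.
Qed.

(** From [expR (x ^+ 2) >= x ^+ 2] the function lies between 0 and [x^-1] for positive [x]. *)
Lemma cvg_x_gauss : (fun x : R => x * gauss_fun x) x @[x --> +oo] --> 0.
Proof.
apply: (squeeze_cvgr (f := cst 0) (h := fun x : R => x^-1)).
- near=> x; have x0 : 0 < x by near: x; exact: nbhs_pinfty_gt.
  rewrite mulr_ge0 ?gauss_fun_ge0 ?(ltW x0)//= /gauss_fun expRN.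
  rewrite ler_pdivrMr ?expR_gt0// mulrC ler_pdivlMr// -expr2.
  by apply: le_trans (expR_ge1Dx _); rewrite lerDr.
- exact: cvg_cst.
- by apply/gtr0_cvgV0; [exact: nbhs_pinfty_gt|exact: cvg_id].
Unshelve. all: by end_near. Qed.

Let cvg_expR1B : (fun x : R => - expR (1 - x)) x @[x --> +oo] --> 0.
Proof.
rewrite -oppr0; apply: cvgN; rewrite -(mulr0 (expR 1)).
under eq_fun do rewrite expRD.
by apply: cvgMl_tmp; exact: cvgr_expR.
Qed.

Let integral_expR1B : (\int[mu]_(x in `[0%R, +oo[) (expR (1 - x))%:E =
  (expR 1)%:E)%E.
Proof.
have d (x : R) : is_derive x 1 (fun x : R => - expR (1 - x)) (expR (1 - x)).
  by apply: is_derive_eq; rewrite /GRing.scale /=; ring.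
rewrite (@ge0_continuous_FTC2y _ _ (fun x => - expR (1 - x)) 0 0).
- by rewrite subr0 -EFinB sub0r opprK.
- by move=> x _; exact: expR_ge0.
- apply: continuous_subspaceT => x.
  apply: (@continuous_comp _ _ _ (fun x : R => 1 - x) expR).
    by apply: cvgB; [exact: cvg_cst|exact: cvg_id].
  exact: continuous_expR.
- exact: cvg_expR1B.
- by move=> x _; have [] := d x.
- exact/cvg_at_right_filter/(is_derive1_continuous d).
- by move=> x _; rewrite derive1E; have [] := d x.
Qed.

(* The derivative of [- x * gauss_fun x / 2 - expR (1 - x)]; the second term
   makes it nonnegative on [[0, +oo[], as [ge0_continuous_FTC2y] requires. *)
Let f (x : R) := (x ^+ 2 - 2^-1) * gauss_fun x + expR (1 - x).

Let f_ge0 x : 0 <= x -> 0 <= f x.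
Proof.
(* Up to 1 the first summand is at least -1/2 while the exponential is at least 1; beyond 1 both
   summands are nonnegative. *)
move=> x0; rewrite /f; have [x1|x1] := lerP x 1.
  have : 1 <= expR (1 - x) by rewrite -[leLHS]expR0 ler_expR subr_ge0.
  have := gauss_fun_le1 x; have := gauss_fun_ge0 x; have := sqr_ge0 x.
  nra.
rewrite addr_ge0 ?expR_ge0// mulr_ge0 ?gauss_fun_ge0//; nra.
Qed.

Let integral_x2_gauss_aux :
  (\int[mu]_(x in `[0%R, +oo[) (f x)%:E = (expR 1)%:E)%E.
Proof.
pose F (x : R) := - (x * gauss_fun x) / 2 - expR (1 - x).
have d (x : R) : is_derive x 1 F (f x).
  rewrite /F /f; apply: is_derive_eq; rewrite /GRing.scale /= /gauss_fun.
  by field.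
rewrite (@ge0_continuous_FTC2y _ f F 0 0).
- by rewrite /F mul0r oppr0 mul0r -EFinB !sub0r opprK addr0.
- exact: f_ge0.
- apply: continuous_subspaceT => x; apply: differentiable_continuous.
  apply/derivable1_diffP; exact: ex_derive.
- rewrite -[X in _ --> X]addr0; apply: cvgD; last exact: cvg_expR1B.
  rewrite -[X in _ --> X](mul0r 2^-1) -oppr0; apply: cvgMr_tmp; apply: cvgN.
  exact: cvg_x_gauss.
- by move=> x _; have [] := d x.
- exact/cvg_at_right_filter/(is_derive1_continuous d).
- by move=> x _; rewrite derive1E; have [] := d x.
Qed.

(** The integrand is even, so twice the half-line integral is taken; there, integration by parts
    reduces it to half the Gaussian integral. *)
Lemma integral_x2_gauss :
  (\int[mu]_x (x ^+ 2 * gauss_fun x)%:E = (Num.sqrt pi / 2)%:E)%E.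
Proof.
have mset : [set x : R | 0 <= x] = `[0, +oo[%classic.
  by apply/seteqP; split => x /=; rewrite in_itv /= andbT.
have mexp : measurable_fun setT (fun x : R => expR (1 - x)).
  by apply: measurableT_comp => //; exact: measurable_funB.
have half : (\int[mu]_(x in `[0%R, +oo[) (x ^+ 2 * gauss_fun x)%:E =
    (Num.sqrt pi / 4)%:E)%E.
  (* Pointwise, [x ^+ 2 * gauss_fun x + expR (1 - x) = f x + 2^-1 * gauss_fun x] with all four terms
     nonnegative, so integrals add up; the finite contribution [expR 1] then cancels. *)
  suff : (\int[mu]_(x in `[0%R, +oo[) (x ^+ 2 * gauss_fun x)%:E +
      \int[mu]_(x in `[0%R, +oo[) (expR (1 - x))%:E =
      \int[mu]_(x in `[0%R, +oo[)
(f x)%:E +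
      \int[mu]_(x in `[0%R, +oo[) (2^-1 * gauss_fun x)%:E)%E.
    rewrite integral_x2_gauss_aux integral_expR1B.
    under [in RHS]eq_integral do rewrite EFinM.
    rewrite ge0_integralZl//; last 2 first.
    - apply/measurable_funTS/measurable_EFinP; exact: measurable_gauss_fun.
    - by move=> x _; rewrite lee_fin gauss_fun_ge0.
    rewrite integral0y_gauss => /(congr1 (fun z => z - (expR 1)%:E)%E).
    rewrite addeK// [X in (X - _)%E]addeC addeK// => ->.
    by rewrite -EFinM; congr (_%:E); field.
  rewrite -!ge0_integralD//=.
  - by apply: eq_integral => x _; rewrite -!EFinD /f; congr (_%:E); field.
  - by move=> x; rewrite in_itv /= andbT lee_fin => /f_ge0.
  - apply/measurable_funTS/measurable_EFinP/measurable_funD => //.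
    apply: measurable_funM; last exact: measurable_gauss_fun.
    exact: measurable_funB.
  - by move=> x _; rewrite lee_fin mulr_ge0 ?gauss_fun_ge0.
  - apply/measurable_funTS/measurable_EFinP/measurable_funM => //.
    exact: measurable_gauss_fun.
  - by move=> x _; rewrite lee_fin mulr_ge0 ?sqr_ge0 ?gauss_fun_ge0.
  - apply/measurable_funTS/measurable_EFinP/measurable_funM => //.
    exact: measurable_gauss_fun.
  - exact/measurable_funTS/measurable_EFinP.
rewrite ge0_symfun_integralT.
- by rewrite mset half -EFinM; congr (_%:E); field.
- by move=> x; rewrite mulr_ge0 ?sqr_ge0 ?gauss_fun_ge0.
- move=> x; apply: (@cvgM _ _ _ _ (fun x => x ^+ 2)).
    exact: exprn_continuous.
  exact: continuous_gauss_fun.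
- by move=> x /=; rewrite /gauss_fun sqrrN.
Qed.

End GaussianMoments.

(** * Expectations under a centred normal law *)

Section NormalLaw.
Context {R : realType}.
Local Notation mu := (@lebesgue_measure R).
Import numFieldNormedType.Exports.

(** The Radon-Nikodym derivative of [normal_prob] and [normal_pdf] have the same integral over every
    measurable set, hence agree almost everywhere. *)
Lemma ge0_integral_normal_prob (m s : R) (f : R -> \bar R) :
  measurable_fun setT f -> (forall x, 0 <= f x)%E ->
  (\int[normal_prob m s]_x f x = \int[mu]_x (f x * (normal_pdf m s x)%:E))%E.
Proof.
move=> mf f0.
have numu := normal_prob_dominates m s.
rewrite -(Radon_Nikodym_SigmaFinite.change_of_variables numu)//.
apply: ae_eq_integral => //.
- apply: emeasurable_funM => //.
  apply: (measurable_int mu).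
  exact: Radon_Nikodym_SigmaFinite.f_integrable numu.
- apply: emeasurable_funM => //.
  by apply/measurable_EFinP; exact: measurable_normal_pdf.
apply: ae_eqe_mul2l; apply: integral_ae_eq => //.
- exact: Radon_Nikodym_SigmaFinite.f_integrable numu.
- by apply/measurable_EFinP; exact: measurable_normal_pdf.
move=> E _ mE.
by rewrite -(Radon_Nikodym_SigmaFinite.f_integral numu).
Qed.

(** At variance 1/2 the exponent is exactly [- x ^+ 2], so the moments of [gauss_fun] apply without
    rescaling. *)
Lemma normal_pdf_gauss (x : R) :
  normal_pdf 0 (Num.sqrt 2^-1) x = gauss_fun x / Num.sqrt pi.
Proof.
have s0 : Num.sqrt 2^-1 != 0 :> R by rewrite sqrtr_eq0 -ltNge.
rewrite normal_pdfE// /normal_fun /normal_peak /gauss_fun.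
by rewrite sqr_sqrtr// subr0 -mulrnAl -mulr_natr mulVf// mul1r divr1 mulrC.
Qed.

(** Lebesgue measure is invariant under negation and the centred density is even. *)
Lemma ge0_integral_normal_pdfN (s : R) (f : R -> \bar R) :
  s != 0 -> measurable_fun setT f -> (forall x, 0 <= f x)%E ->
  (\int[mu]_x (f (- x)%R * (normal_pdf 0 s x)%:E) =
   \int[mu]_x (f x * (normal_pdf 0 s x)%:E))%E.
Proof.
move=> s0 mf f0.
have pN x : normal_pdf 0 s (- x) = normal_pdf 0 s x.
  by rewrite !normal_pdfE// /normal_fun !subr0 sqrrN.
transitivity (\int[pushforward mu (-%R : _ -> measurableTypeR R)]_x
    (f x * (normal_pdf 0 s x)%:E))%E; last first.
  by apply: eq_measure_integral => A mA _; exact: lebesgue_measureN.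
have mg : measurable_fun setT (fun x : R => f x * (normal_pdf 0 s x)%:E)%E.
  apply: emeasurable_funM => //; apply/measurable_EFinP.
  exact: measurable_normal_pdf.
have mN : measurable_fun setT (-%R : measurableTypeR R -> measurableTypeR R).
  exact: oppr_measurable.
have g0 : {in setT, forall x : R, 0 <= f x * (normal_pdf 0 s x)%:E}%E.
  by move=> x _; rewrite mule_ge0// lee_fin normal_pdf_ge0.
have := ge0_integral_pushforward mN mu measurableT mg g0.
by move=> /= ->; apply: eq_integral => x _; rewrite /= pN.
Qed.

Context d (T : measurableType d) (P : probability T R).

(** Integrability is bundled with the value so that the rules for sums, multiples and products chain
    without side conditions. *)
Definition has_mean (X : T -> R) (m : R) :=
  P.-integrable setT (EFin \o X) /\ (\int[P]_w (X w)%:E = m%:E)%E.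

Section NormalVariable.
Variables (X : T -> R) (s : R).
Hypothesis mX : measurable_fun setT X.
Hypothesis lawX : forall B, measurable B -> P (X @^-1` B) = normal_prob 0 s B.

Lemma ge0_integral_normal_rv (f : R -> \bar R) :
  measurable_fun setT f -> (forall x, 0 <= f x)%E ->
  (\int[P]_w f (X w) = \int[mu]_x (f x * (normal_pdf 0 s x)%:E))%E.
Proof.
move=> mf f0; rewrite -ge0_integral_normal_prob//.
rewrite -(@ge0_integral_pushforward _ _ _ (measurableTypeR R) R X mX P setT)//.
apply: eq_measure_integral => B mB _; exact: lawX.
Qed.

(** The law is symmetric, and the negative part of [X] is the positive part of [- X]. Working with
    nonnegative functions allows this before integrability is known. *)
Lemma integral_normal_rv_pos_neg : s != 0 ->
  (\int[P]_w ((EFin \o X)^\+ w) = \int[P]_w ((EFin \o X)^\- w))%E.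
Proof.
move=> s0; pose pos (x : R) : \bar R := maxe x%:E 0.
have mpos : measurable_fun setT pos by exact: measurable_maxe.
have pos0 x : (0 <= pos x)%E by rewrite le_max lexx orbT.
have mN : measurable_fun setT (fun x : R => pos (- x)).
  exact: measurableT_comp.
transitivity (\int[P]_w pos (X w))%E.
  by apply: eq_integral => w _; rewrite funeposE.
transitivity (\int[P]_w pos (- X w)%R)%E; last first.
  by apply: eq_integral => w _; rewrite funenegE.
have e1 := ge0_integral_normal_rv mpos pos0.
have e2 := ge0_integral_normal_rv mN (fun x => pos0 (- x)).
have e3 := ge0_integral_normal_pdfN s0 mpos pos0.
exact: etrans e1 (esym (etrans e2 e3)).
Qed.

End NormalVariable.

Lemma normal_rv_sqr (X : T -> R) :
  measurable_fun setT X ->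
  (forall B, measurable B -> P (X @^-1` B) = normal_prob 0 (Num.sqrt 2^-1) B) ->
  has_mean (fun w => X w ^+ 2) 2^-1.
Proof.
move=> mX lawX.
have m2 : measurable_fun setT (fun x : R => (x ^+ 2)%:E).
  exact/measurable_EFinP/measurable_funX.
have e : (\int[P]_w (X w ^+ 2)%:E = (2^-1)%:E)%E.
  rewrite (ge0_integral_normal_rv mX lawX m2); last first.
    by move=> x; rewrite lee_fin sqr_ge0.
  under eq_integral do rewrite normal_pdf_gauss -EFinM mulrA EFinM.
  rewrite ge0_integralZr//; last 2 first.
  - apply/measurable_EFinP/measurable_funM => //; exact: measurable_gauss_fun.
  - by move=> x _; rewrite lee_fin mulr_ge0 ?sqr_ge0 ?gauss_fun_ge0.
  rewrite integral_x2_gauss -EFinM mulrAC divff ?mul1r//.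
  by rewrite gt_eqF// sqrtr_gt0 pi_gt0.
split => //; apply/integrableP; split.
  by apply/measurable_EFinP/measurable_funX.
under eq_integral do rewrite gee0_abs ?lee_fin ?sqr_ge0//.
by rewrite e ltry.
Qed.

(** Domination by [1 + X w ^+ 2], whose constant is integrable because [P] is finite. *)
Lemma integrable_of_sqr (X : T -> R) :
  measurable_fun setT X ->
  P.-integrable setT (fun w => (X w ^+ 2)%:E) -> P.-integrable setT (EFin \o X).
Proof.
move=> mX h; apply: (@le_integrable _ _ _ _ _ measurableT _
  (fun w => 1%:E + (X w ^+ 2)%:E)%E).
- exact/measurable_EFinP.
- move=> x _; rewrite -EFinD !abse_EFin lee_fin.
  rewrite [leRHS]ger0_norm ?addr_ge0 ?sqr_ge0//.
  rewrite ler_norml; apply/andP; split; nra.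
- by apply: integrableD => //; exact: finite_measure_integrable_cst.
Qed.

Lemma normal_rv_mean (X : T -> R) :
  measurable_fun setT X ->
  (forall B, measurable B -> P (X @^-1` B) = normal_prob 0 (Num.sqrt 2^-1) B) ->
  has_mean X 0.
Proof.
move=> mX lawX; have [i2 _] := normal_rv_sqr mX lawX.
have iX := integrable_of_sqr mX i2; split => //.
(* The equal integrals of the two parts cancel because integrability makes them finite. *)
rewrite integralE (integral_normal_rv_pos_neg mX lawX) ?subee//.
by rewrite integrable_neg_fin_num.
Qed.

End NormalLaw.

(** * Products of independent random variables *)

Section Independence.
Context {R : realType} d (T : measurableType d) (P : probability T R).

Lemma integrable_distributionP d' (T' : measurableType d') (X : {RV P >-> T'})
    (f : T' -> \bar R) : measurable_fun setT f ->
  (distribution P X).-integrable setT f <-> P.-integrable setT (f \o X).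
Proof.
move=> mf.
have mfX : measurable_fun setT (f \o X) by exact: measurableT_comp.
have maf : measurable_fun setT (fun x => `|f x|)%E by exact: measurableT_comp.
have := ge0_integral_distribution X maf (fun=> abse_ge0 _) => e.
by split => /integrableP[_ h]; apply/integrableP; split => //;
  move: h; rewrite e.
Qed.

(** Independence makes the joint law of the pair the product of the marginal laws, and Fubini
    factors the integral of [z.1 * z.2]. *)
Lemma has_mean_mul_indep (X Y : T -> R) (a b : R) :
  (forall A B : set R, measurable A -> measurable B ->
    P (X @^-1` A `&` Y @^-1` B) = P (X @^-1` A) * P (Y @^-1` B))%E ->
  has_mean P X a -> has_mean P Y b -> has_mean P (fun w => X w * Y w) (a * b).
Proof.
move=> ind [iX eX] [iY eY].
have mX : measurable_fun setT X by exact/measurable_EFinP/(measurable_int P).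
have mY : measurable_fun setT Y by exact/measurable_EFinP/(measurable_int P).
pose X' : {mfun T >-> R} := HB.pack X (isMeasurableFun.Build _ _ _ _ X mX).
pose Y' : {mfun T >-> R} := HB.pack Y (isMeasurableFun.Build _ _ _ _ Y mY).
pose Z w := (X w, Y w).
have mZ : measurable_fun setT Z by exact: measurable_fun_pair.
pose Z' : {mfun T >-> (R * R)%type} :=
  HB.pack Z (isMeasurableFun.Build _ _ _ _ Z mZ).
pose m1 := distribution P X'; pose m2 := distribution P Y'.
pose m := distribution P Z'.
(* A measure that agrees with the product on rectangles is the product measure. *)
have mE A : measurable A -> (m1 \x m2)%E A = m A.
  by move=> mA; apply: product_measure_unique => // B C mB mC; exact: ind.
pose f (z : R * R) : \bar R := (z.1 * z.2)%:E.
have mf : measurable_fun setT f.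
  by apply/measurable_EFinP/measurable_funM.
have mid : measurable_fun setT (EFin : R -> \bar R) by exact/measurable_EFinP.
have i1 : m1.-integrable setT (EFin : R -> \bar R).
  exact/integrable_distributionP.
have i2 : m2.-integrable setT (EFin : R -> \bar R).
  exact/integrable_distributionP.
have [_ fX] := integrableP _ _ _ i1; have [_ fY] := integrableP _ _ _ i2.
have ifm : (m1 \x m2)%E.-integrable setT f.
  (* By Tonelli it suffices that the iterated integral of the absolute value is finite; it is the
     product of two finite absolute moments. *)
  apply/(integrable12ltyP _ _ mf).
  have inner x : (\int[m2]_y `|f (x, y)| = `|x%:E| * \int[m2]_y `|y%:E|)%E.
    rewrite -ge0_integralZl//; last exact: measurableT_comp.
    by apply: eq_integral => y _; rewrite /f EFinM abseM.
  under eq_integral do rewrite inner.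
  rewrite ge0_integralZr//; last 2 first.
  - exact: measurableT_comp.
  - exact: integral_ge0.
  by rewrite lte_mul_pinfty ?integral_ge0// ge0_fin_numE ?integral_ge0.
have ifP : P.-integrable setT (f \o Z).
  apply/(integrable_distributionP Z' mf).
  apply/integrableP; split => //; have /integrableP[_] := ifm.
  by rewrite (eq_measure_integral m)// => A mA _; exact: mE.
split => //.
transitivity (\int[P]_w (f \o Z') w)%E; first by [].
rewrite -integral_distribution//.
rewrite (eq_measure_integral (m1 \x m2)%E) => [|A mA _]; last exact/esym/mE.
rewrite -integral12_prod_meas1//.
have e1 : (\int[m1]_x x%:E = a%:E)%E by rewrite integral_distribution.
have e2 : (\int[m2]_x x%:E = b%:E)%E by rewrite integral_distribution.
have inner x : fubini_F m2 f x = (x%:E * b%:E)%E.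
  transitivity (\int[m2]_y (x%:E * y%:E))%E; first by [].
  by rewrite integralZl// e2.
rewrite (_ : fubini_F _ _ = (fun x : R => x%:E * b%:E)%E); last exact/funext.
by rewrite integralZr// e1.
Qed.
End Independence.

(** * Means of random matrices *)

Section Means.
Context {R : realType} d (T : measurableType d) (P : probability T R).
Local Notation C := R[i].
Local Notation has_mean := (has_mean P).

Lemma eq_has_mean (X Y : T -> R) a b : X =1 Y -> a = b ->
  has_mean X a -> has_mean Y b.
Proof. by move=> /funext -> ->. Qed.

Lemma has_mean_cst (a : R) : has_mean (fun=> a) a.
Proof.
split; first exact: finite_measure_integrable_cst.
by rewrite (integral_cst _ measurableT) [X in (_ * X)%E]probability_setT mule1.
Qed.

Lemma has_meanD (X Y : T -> R) a b : has_mean X a -> has_mean Y b ->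
  has_mean (fun w => X w + Y w) (a + b).
Proof.
move=> [iX eX] [iY eY]; split; first exact: (integrableD measurableT iX iY).
by under eq_integral do rewrite EFinD; rewrite integralD// eX eY.
Qed.

Lemma has_meanZ (c : R) (X : T -> R) a : has_mean X a ->
  has_mean (fun w => c * X w) (c * a).
Proof.
move=> [iX eX]; split; first exact: (integrableZl measurableT c iX).
by under eq_integral do rewrite EFinM; rewrite integralZl// eX.
Qed.

Lemma has_meanB (X Y : T -> R) a b : has_mean X a -> has_mean Y b ->
  has_mean (fun w => X w - Y w) (a - b).
Proof.
move=> hX /(has_meanZ (-1)) hY; apply: eq_has_mean (has_meanD hX hY) => [w|];
  by rewrite mulN1r.
Qed.

Definition has_cmean (X : T -> C) (z : C) :=
  has_mean (fun w => complex.Re (X w)) (complex.Re z) /\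
  has_mean (fun w => complex.Im (X w)) (complex.Im z).

Lemma has_cmean_cst (z : C) : has_cmean (fun=> z) z.
Proof. by split; exact: has_mean_cst. Qed.

Lemma has_cmeanD (X Y : T -> C) a b : has_cmean X a -> has_cmean Y b ->
  has_cmean (fun w => X w + Y w) (a + b).
Proof.
move=> [rX iX] [rY iY]; split.
- apply: eq_has_mean (has_meanD rX rY) => [w|].
    by case: (X w); case: (Y w).
  by case: a b {rX rY iX iY} => [? ?] [? ?].
- apply: eq_has_mean (has_meanD iX iY) => [w|].
    by case: (X w); case: (Y w).
  by case: a b {rX rY iX iY} => [? ?] [? ?].
Qed.

Lemma has_cmeanZ (c : C) (X : T -> C) a : has_cmean X a ->
  has_cmean (fun w => c * X w) (c * a).
Proof.
case: c => c c' [rX iX]; split.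
- apply: eq_has_mean (has_meanB (has_meanZ c rX) (has_meanZ c' iX)) => [w|].
    by case: (X w).
  by case: a {rX iX}.
- apply: eq_has_mean (has_meanD (has_meanZ c iX) (has_meanZ c' rX)) => [w|].
    by case: (X w).
  by case: a {rX iX}.
Qed.

Lemma has_cmean_conj (X : T -> C) a : has_cmean X a ->
  has_cmean (fun w => (X w)^*) a^*.
Proof.
move=> [rX iX]; split.
- apply: eq_has_mean rX => [w|]; first by case: (X w).
  by case: a {iX}.
- apply: eq_has_mean (has_meanZ (-1) iX) => [w|].
    by case: (X w) => ? ? /=; rewrite mulN1r.
  by case: a {rX iX} => ? ? /=; rewrite mulN1r.
Qed.

Lemma has_cmean_sum I (r : seq I) (X : I -> T -> C) a :
  (forall i, has_cmean (X i) (a i)) ->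
  has_cmean (fun w => \sum_(i <- r) X i w) (\sum_(i <- r) a i).
Proof.
move=> h; elim: r => [|i r IH].
  by rewrite big_nil; under eq_fun do rewrite big_nil; exact: has_cmean_cst.
by rewrite big_cons; under eq_fun do rewrite big_cons; exact: has_cmeanD.
Qed.

Definition has_mxmean m n (X : T -> 'M[C]_(m, n)) (A : 'M[C]_(m, n)) :=
  forall i j, has_cmean (fun w => X w i j) (A i j).

Lemma has_mxmean_cst m n (A : 'M[C]_(m, n)) : has_mxmean (fun=> A) A.
Proof. by move=> i j; exact: has_cmean_cst. Qed.

Lemma has_mxmeanD m n (X Y : T -> 'M[C]_(m, n)) A B :
  has_mxmean X A -> has_mxmean Y B -> has_mxmean (fun w => X w + Y w) (A + B).
Proof.
move=> hX hY i j; rewrite mxE; under eq_fun do rewrite mxE.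
exact: has_cmeanD.
Qed.

Lemma has_mxmean_sum I (r : seq I) m n (X : I -> T -> 'M[C]_(m, n)) A :
  (forall i, has_mxmean (X i) (A i)) ->
  has_mxmean (fun w => \sum_(i <- r) X i w) (\sum_(i <- r) A i).
Proof.
move=> h i j; rewrite summxE; under eq_fun do rewrite summxE.
by apply: has_cmean_sum => k; exact: h.
Qed.

Lemma has_mxmeanMl m n p (B : 'M[C]_(m, n)) (X : T -> 'M[C]_(n, p)) A :
  has_mxmean X A -> has_mxmean (fun w => B *m X w) (B *m A).
Proof.
move=> h i j; rewrite mxE; under eq_fun do rewrite mxE.
by apply: has_cmean_sum => k; apply: has_cmeanZ; exact: h.
Qed.

Lemma has_mxmean_adj m n (X : T -> 'M[C]_(m, n)) A :
  has_mxmean X A -> has_mxmean (fun w => adjmx (X w)) (adjmx A).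
Proof.
move=> h i j; rewrite !mxE; under eq_fun do rewrite !mxE.
exact: has_cmean_conj.
Qed.

(** Taking adjoints before and after turns right multiplication into left multiplication. *)
Lemma has_mxmeanMr m n p (B : 'M[C]_(n, p)) (X : T -> 'M[C]_(m, n)) A :
  has_mxmean X A -> has_mxmean (fun w => X w *m B) (A *m B).
Proof.
move=> h; rewrite -[A *m B]adjmxK adjmxM.
rewrite (_ : (fun w => _) = fun w => adjmx (adjmx B *m adjmx (X w))).
  exact: (has_mxmean_adj (has_mxmeanMl _ (has_mxmean_adj h))).
by apply/funext => w; rewrite adjmxM !adjmxK.
Qed.

Lemma has_cmean_tr n (X : T -> 'M[C]_n) A :
  has_mxmean X A -> has_cmean (fun w => \tr (X w)) (\tr A).
Proof. by move=> h; apply: has_cmean_sum => i; exact: h. Qed.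

End Means.

(** * First and second moments of a complex Gaussian vector *)

Section GaussianVector.
Context {R : realType} d (T : measurableType d) (P : probability T R).
Variables (N : nat) (g : T -> 'cV[R[i]]_N).
Hypothesis hg : std_cgauss_vec P g.

Let comp (p : 'I_N * bool) (w : T) : R :=
  if p.2 then complex.Re (g w p.1 0) else complex.Im (g w p.1 0).

Let mean_comp p : has_mean P (comp p) 0.
Proof. by case: hg => m l _; exact: normal_rv_mean (m p) (l p). Qed.

Let mean_comp_sqr p : has_mean P (fun w => comp p w * comp p w) 2^-1.
Proof. by case: hg => m l _; exact: normal_rv_sqr (m p) (l p). Qed.

Let mean_comp_mul p q : p != q -> has_mean P (fun w => comp p w * comp q w) 0.
Proof.
move=> pq; rewrite -[X in has_mean _ _ X](mul0r 0).
apply: has_mean_mul_indep => // A B mA mB.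
case: hg => _ _ ind.
(* Mutual independence concerns all coordinates at once; taking the full set at every coordinate
   other than [p] and [q] contributes factors 1 and leaves the pairwise statement. *)
pose D r : set R := if r == p then A else if r == q then B else setT.
have mD r : measurable (D r) by rewrite /D; case: ifP => // _; case: ifP.
have := ind D mD.
rewrite (bigD1 p)//= (bigD1 q) 1?eq_sym//= big1; last first.
  move=> r /andP[/negPf rp /negPf rq]; rewrite /D rp rq preimage_setT.
  exact: probability_setT.
rewrite mule1 /D eqxx eq_sym (negPf pq) eqxx => <-; congr (P _).
apply/seteqP; split => [w [Xw Yw] r _ /=|w h].
  by case: eqVneq => [->//|_]; case: eqVneq => [->//|_].
split.
  by have := h p I; rewrite /= eqxx.
by have := h q I; rewrite /= eqxx eq_sym (negPf pq).
Qed.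

Lemma std_cgauss_mean : has_mxmean P g 0.
Proof.
move=> i j; rewrite (ord1 j) mxE; split; first exact: (mean_comp (i, true)).
exact: (mean_comp (i, false)).
Qed.

(** On the diagonal, the real and imaginary parts each contribute variance 1/2; every other product
    pairs distinct independent centred coordinates. *)
Lemma std_cgauss_cov : has_mxmean P (fun w => g w *m adjmx (g w)) 1%:M.
Proof.
move=> i j.
have e w : (g w *m adjmx (g w)) i j =
    (comp (i, true) w * comp (j, true) w +
     comp (i, false) w * comp (j, false) w) +i*
    (comp (i, false) w * comp (j, true) w -
     comp (i, true) w * comp (j, false) w).
  rewrite mxE big_ord1 !mxE /comp /=.
  by case: (g w i 0) => a b; case: (g w j 0) => a' b' /=;
     apply/eqP; rewrite eq_complex /=; apply/andP; split; apply/eqP; ring.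
under eq_fun do rewrite e.
(* A real part and an imaginary part are distinct coordinates even when [i = j]. *)
have cross b c : b != c ->
    has_mean P (fun w => comp (i, b) w * comp (j, c) w) 0.
  by move=> bc; apply: mean_comp_mul; rewrite xpair_eqE (negPf bc) andbF.
split => /=; rewrite mxE.
  have same b : has_mean P (fun w => comp (i, b) w * comp (j, b) w)
      ((i == j)%:R / 2).
    case: eqVneq => [->|ij]; first by rewrite mul1r; exact: mean_comp_sqr.
    by rewrite mul0r; apply: mean_comp_mul; rewrite xpair_eqE (negPf ij).
  apply: eq_has_mean (has_meanD (same true) (same false)) => //.
  by rewrite -splitr; case: (i == j).
have := has_meanB (cross false true isT) (cross true false isT).
apply: eq_has_mean => //.
by rewrite subr0; case: (i == j).
Qed.

(** Of the four terms of the expanded product, the two mixed ones are linear in [g] or its adjoint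
    and have mean zero, while the quadratic one has mean [M *m 1%:M *m adjmx M]. *)
Let affine_cov m (a : 'cV[R[i]]_m) (M : 'M[R[i]]_(m, N)) :
  has_mxmean P (fun w => (a + M *m g w) *m adjmx (a + M *m g w))
    (a *m adjmx a + M *m adjmx M).
Proof.
have h0 : has_mxmean P (fun w => M *m g w *m adjmx a) 0.
  rewrite -[X in has_mxmean _ _ X](mul0mx _ (adjmx a)) -(mulmx0 _ M).
  by apply/has_mxmeanMr/has_mxmeanMl; exact: std_cgauss_mean.
have h1 : has_mxmean P (fun w => a *m adjmx (M *m g w)) 0.
  rewrite -[X in has_mxmean _ _ X](mulmx0 _ a).
  have adj0 : adjmx (M *m (0 : 'cV_N)) = 0.
    by rewrite mulmx0; apply/matrixP => i j; rewrite !mxE conjc0.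
  rewrite -adj0.
  by apply/has_mxmeanMl/has_mxmean_adj/has_mxmeanMl; exact: std_cgauss_mean.
have h2 : has_mxmean P (fun w => M *m g w *m adjmx (M *m g w)) (M *m adjmx M).
  have := has_mxmeanMr (adjmx M) (has_mxmeanMl M std_cgauss_cov).
  rewrite mulmx1; congr has_mxmean; apply/funext => w.
  by rewrite adjmxM !mulmxA.
have := has_mxmeanD (has_mxmeanD (has_mxmean_cst P (a *m adjmx a)) h1)
  (has_mxmeanD h0 h2).
rewrite addr0 add0r.
congr has_mxmean; apply/funext => w.
by rewrite adjmxD mulmxDr !mulmxDl addrACA [X in _ + X]addrC addrA.
Qed.

Lemma affine_cgauss_cov m (a : 'cV[R[i]]_m) (c : R[i]) (M : 'M[R[i]]_(m, N)) :
  has_mxmean P (fun w => (a + c *: (M *m g w)) *m adjmx (a + c *: (M *m g w)))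
    (a *m adjmx a + (c *: M) *m adjmx (c *: M)).
Proof.
have := affine_cov a (c *: M); congr has_mxmean.
by apply/funext => w; rewrite scalemxAl.
Qed.

End GaussianVector.

(** * Gram matrices of block matrices *)

Lemma adjmx_row_mx (R : realType) m n1 n2 (A : 'M[R[i]]_(m, n1))
    (B : 'M[R[i]]_(m, n2)) :
  row_mx A B *m adjmx (row_mx A B) = A *m adjmx A + B *m adjmx B.
Proof. by rewrite {1}/adjmx map_row_mx tr_row_mx mul_row_col. Qed.

(** [G] is the horizontal concatenation of the blocks [A k]: [mxvec] numbers its columns by pairs
    [(k, c)], and reindexing by these pairs splits the column sum into one sum per block. *)
Lemma gram_mxvec (R : realType) m n p (A : 'I_n -> 'M[R[i]]_(m, p)) :
  let G : 'M[R[i]]_(m, n * p) :=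
    \matrix_(i < m) mxvec (\matrix_(k, c) A k i c) in
  G *m adjmx G = \sum_k A k *m adjmx (A k).
Proof.
move=> G; apply/matrixP => i j; rewrite mxE summxE.
rewrite (reindex _ (curry_mxvec_bij n p)) /=.
transitivity (\sum_k \sum_c A k i c * (A k j c)^*).
  rewrite pair_bigA; apply: eq_bigr => -[k c] _ /=.
  by rewrite !mxE !mxvecE !mxE.
by apply: eq_bigr => k _; rewrite mxE; apply: eq_bigr => c _; rewrite !mxE.
Qed.

(* The integral is a difference of suprema over simple functions below the
   positive and negative parts, hence monotone without measurability. *)
Lemma le_integral_nonmeasurable d (T : measurableType d) (R : realType)
    (mu : {measure set T -> \bar R}) (f g : T -> \bar R) :
  (forall x, f x <= g x)%E -> (\int[mu]_x f x <= \int[mu]_x g x)%E.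
Proof.
move=> fg; rewrite /integral !patch_setT; apply: leeB.
- apply: ereal_sup_le => _ [h /= hf <-]; exists h => // x /=.
  apply: le_trans (hf x) _; rewrite !funeposE.
  by rewrite ge_max !le_max lexx fg orbT.
- apply: ereal_sup_le => _ [h /= hg <-]; exists h => // x /=.
  apply: le_trans (hg x) _; rewrite !funenegE.
  by rewrite ge_max !le_max lexx leeN2 fg orbT.
Qed.

(** * Jensen's inequality for log det and the rate bound *)

Lemma logdet_jensen d (T : measurableType d) (R : realType)
    (P : probability T R) n (X : T -> 'M[R[i]]_n) (Y B : 'M[R[i]]_n) :
  (forall w, posdef (X w)) -> posdef Y -> posdef B -> has_mxmean P X Y ->
  (\int[P]_w (logdet (X w *m invmx B))%:E <= (logdet (Y *m invmx B))%:E)%E.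
Proof.
move=> hX hY hB mX; set c := logdet (Y *m invmx B).
(* The tangent is taken at the mean [Y], so the trace averages to that of [Y *m invmx Y], which is
   [n]; the linear correction then has mean zero. *)
have mean_tr : has_mean P (fun w => complex.Re (\tr (X w *m invmx Y))) n%:R.
  have [+ _] := has_cmean_tr (has_mxmeanMr (invmx Y) mX).
  rewrite mulmxV ?posdef_unit// mxtrace1.
  by apply: eq_has_mean => //; rewrite -(rmorph_nat (real_complex R)).
have [_ <-] : has_mean P
    (fun w => c + (complex.Re (\tr (X w *m invmx Y)) - n%:R)) c.
  have := has_meanD (has_mean_cst P c)
    (has_meanB mean_tr (has_mean_cst P n%:R)).
  by rewrite subrr addr0.
apply: le_integral_nonmeasurable => w; rewrite lee_fin.
exact: logdet_tangent.
Qed.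

Theorem theorem1 (R : realType) (d : measure_display) (T : measurableType d)
  (P : probability T R) (S L K : nat)
  (hS : (0 < S)%N) (hL : (0 < L)%N) (hK : (0 < K)%N)
  (q : 'I_L -> 'I_S -> R[i]) (hq : forall l s, @dma_weights R (q l s))
  (Q : 'M[R[i]]_(L * S, L))
  (hQ : forall (l1 l2 : 'I_L) (s : 'I_S),
      Q (mxvec_index l1 s) l2 = if l1 == l2 then q l1 s else 0)
  (H : 'M[R[i]]_(L * S)) (hH : is_diag_mx H)
  (N0 : R) (hN0 : 0 < N0)
  (hP : N0%:C *: (adjmx Q *m adjmx H *m H *m Q) \in unitmx)
  (alpha : 'I_K -> R) (halpha : forall k, 0 < alpha k)
  (K0 : R) (hK0 : 0 <= K0)
  (gbar : 'I_K -> 'cV[R[i]]_(L * S))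
  (Rk Rsqrt : 'I_K -> 'M[R[i]]_(L * S))
  (hRk : forall k, psd (Rk k))
  (hRsqrt : forall k, psd (Rsqrt k) /\ Rsqrt k *m Rsqrt k = Rk k)
  (ghat : 'I_K -> T -> 'cV[R[i]]_(L * S))
  (hghat : forall k, std_cgauss_vec P (ghat k)) :
  let Pm := N0%:C *: (adjmx Q *m adjmx H *m H *m Q) in
  let c1 k := (Num.sqrt (alpha k * K0 / (1 + K0)))%:C in
  let c2 k := (Num.sqrt (alpha k / (1 + K0)))%:C in
  let g k w := c1 k *: gbar k + c2 k *: (Rsqrt k *m ghat k w) in
  let Gt k : 'M[R[i]]_(L * S, 1 + L * S) :=
    row_mx (c1 k *: gbar k) (c2 k *: Rsqrt k) in
  let G : 'M[R[i]]_(L * S, K * (1 + L * S)) :=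
    \matrix_(i < L * S) mxvec (\matrix_(k < K, c < 1 + L * S) Gt k i c) in
  (\int[P]_w (logdet (1%:M + adjmx Q *m adjmx H
                  *m (\sum_(k < K) g k w *m adjmx (g k w)) *m H *m Q *m invmx Pm))%:E
   <= (logdet (1%:M + adjmx Q *m adjmx H *m (G *m adjmx G) *m H *m Q
                  *m invmx Pm))%:E)%E.
Proof.
pose F := adjmx Q *m adjmx H.
pose Pm := N0%:C *: (adjmx Q *m adjmx H *m H *m Q).
pose c1 k := (Num.sqrt (alpha k * K0 / (1 + K0)))%:C.
pose c2 k := (Num.sqrt (alpha k / (1 + K0)))%:C.
pose g k w := c1 k *: gbar k + c2 k *: (Rsqrt k *m ghat k w).
pose Gt k := row_mx (c1 k *: gbar k) (c2 k *: Rsqrt k).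
pose G : 'M[R[i]]_(L * S, K * (1 + L * S)) :=
  \matrix_(i < L * S) mxvec (\matrix_(k < K, c < 1 + L * S) Gt k i c).
pose cov w := \sum_(k < K) g k w *m adjmx (g k w).
suff : (\int[P]_w (logdet (1%:M + F *m cov w *m H *m Q *m invmx Pm))%:E <=
  (logdet (1%:M + F *m (G *m adjmx G) *m H *m Q *m invmx Pm))%:E)%E by [].
have adjF : adjmx F = H *m Q by rewrite adjmxM !adjmxK.
have PmE : Pm = N0%:C *: (F *m adjmx F) by rewrite adjF /Pm /F !mulmxA.
(* The assumed invertibility upgrades this Gram matrix from semidefinite to definite. *)
have pdP : posdef Pm by rewrite PmE; apply: posdef_gram => //; rewrite -PmE.
pose X (B : 'M[R[i]]_(L * S)) := Pm + F *m B *m adjmx F.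
(* The identity is absorbed as [Pm *m invmx Pm], which leaves a quotient whose numerator is affine
   in [B]. *)
have XE B : 1%:M + F *m B *m H *m Q *m invmx Pm = X B *m invmx Pm.
  by rewrite mulmxDl mulmxV// adjF !mulmxA.
have pdX B : possemidef B -> posdef (X B).
  by move=> hB; apply: posdefD => //; exact: possemidef_congr.
have pdcov w : posdef (X (cov w)).
  by apply/pdX/possemidef_sum => k; exact: possemidef_gram.
have pdY : posdef (X (G *m adjmx G)) by exact/pdX/possemidef_gram.
(* Block by block: the two parts of [Gt k] produce the deterministic and the random part of the
   second moment of [g k], and expectation is linear in the sum over [k]. *)
have mean_cov : has_mxmean P cov (G *m adjmx G).
  rewrite /G gram_mxvec; apply: has_mxmean_sum => k.
  rewrite adjmx_row_mx; exact: affine_cgauss_cov.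
rewrite XE; under eq_integral do rewrite XE.
apply: logdet_jensen => //.
apply: has_mxmeanD; first exact: has_mxmean_cst.
exact/has_mxmeanMr/has_mxmeanMl.
Qed.
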